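(* Let $R$ be a right duo ring. Then every $R$-module is fusible if and only if $R$ is a division ring.
   Context: Rings are associative with identity $1\neq 0$; modules are unital right modules. A ring $R$ is right duo if $Ra\subseteq aR$ for every $a\in R$. For a right $R$-module $M$ and $m\in M$, $ann_R(m)=\{r\in R: mr=0\}$; $T_R(M)=\{m\in M: ann_R(m)\neq 0\}$ is the set of torsion elements and $T_R^{\star}(M)=\{m\in M: ann_R(m)=0\}$ the set of torsion free elements. $M$ is fusible if every nonzero element of $M$ can be written as $x+y$ with $x\in T_R(M)$ and $y\in T_R^{\star}(M)$. *)

(* Defs.v *)
From HB Require Import structures.
From mathcomp Require Import all_boot all_order all_algebra.
From mathcomp Require Import boolp classical_sets.

Set Implicit Arguments.
Unset Strict Implicit.
Unset Printing Implicit Defensive.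

Import GRing.Theory.
Local Open Scope ring_scope.
Local Open Scope classical_set_scope.

(* A right R-module is a left module over the converse ring R^c, so that      *)
(* (m r) s = m (r s).                                                         *)
Notation rmodType R := (lmodType R^c).

Definition rscale (R : nzRingType) (M : rmodType R) (m : M) (r : R) : M :=
  (r : R^c) *: m.

Definition right_duo (R : nzRingType) : Prop :=
  forall a : R, [set r * a | r in [set: R]] `<=` [set a * r | r in [set: R]].

Definition division_ring (R : nzRingType) : Prop :=
  forall a : R, a != 0 -> exists b : R, a * b = 1 /\ b * a = 1.

Definition ann (R : nzRingType) (M : rmodType R) (m : M) : set R :=
  [set r | rscale m r = 0].

Definition torsion (R : nzRingType) (M : rmodType R) : set M :=
  [set m | ann m <> [set 0]].

Definition torsion_free (R : nzRingType) (M : rmodType R) : set M :=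
  [set m | ann m = [set 0]].

Definition fusible (R : nzRingType) (M : rmodType R) : Prop :=
  forall m : M, m != 0 ->
    exists x y : M, [/\ torsion x, torsion_free y & m = x + y].

Lemma rscaleA (R : nzRingType) (M : rmodType R) (m : M) (r s : R) :
  rscale (rscale m r) s = rscale m (r * s).
Proof. by rewrite /rscale scalerA. Qed.

(* Main.v *)
Require Import Defs.
From mathcomp Require Import all_boot all_order all_algebra.
From HB Require Import structures.
From mathcomp Require Import boolp classical_sets.

Import GRing.Theory.
Local Open Scope ring_scope.
Local Open Scope quotient_scope.

(** If R is a division ring, then a nonzero element m of a module has
    annihilator 0, and m = 0 + m already has the required form because 0 is
    torsion.  For the converse the test module is the cyclic module R / aR.
    It is killed by a as soon as R is right duo: ra lies in aR for every r.
    Hence, when a is nonzero, it has no torsion free element, and a module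
    without torsion free elements is fusible only if it is zero.  So R = aR
    for every nonzero a, that is, every nonzero element has a right inverse,
    and this forces R to be a division ring. *)

(** The predicate is boolean, by classical logic, because quotients of additive
    groups are formed by boolean subgroups. *)
Definition principal_right_ideal (R : nzRingType) (a : R) : {pred R} :=
  fun x => `[< exists r, x = a * r >].

Lemma principal_right_idealP (R : nzRingType) (a x : R) :
  reflect (exists r, x = a * r) (x \in principal_right_ideal R a).
Proof. exact: asboolP. Qed.

Fact principal_right_ideal_zmod_closed (R : nzRingType) (a : R) :
  zmod_closed (principal_right_ideal R a).
Proof.
split; first by apply/principal_right_idealP; exists 0; rewrite mulr0.
move=> x y /principal_right_idealP[r ->] /principal_right_idealP[s ->].
by apply/principal_right_idealP; exists (r - s); rewrite mulrBr.
Qed.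

HB.instance Definition _ (R : nzRingType) (a : R) :=
  GRing.isZmodClosed.Build R (principal_right_ideal R a)
    (principal_right_ideal_zmod_closed R a).

Lemma principal_right_idealMr (R : nzRingType) (a x r : R) :
  x \in principal_right_ideal R a -> x * r \in principal_right_ideal R a.
Proof.
move=> /principal_right_idealP[s ->].
by apply/principal_right_idealP; exists (s * r); rewrite mulrA.
Qed.

(** A separate name for the additive quotient R / aR, so that the right module
    structure is attached to this type and not to every quotient of R. *)
Definition cyclic_quotient (R : nzRingType) (a : R) : Type :=
  {ideal_quot (principal_right_ideal R a)}.

HB.instance Definition _ (R : nzRingType) (a : R) :=
  GRing.Zmodule.on (cyclic_quotient R a).

Definition cyclic_class (R : nzRingType) (a x : R) : cyclic_quotient R a :=
  \pi_({ideal_quot (principal_right_ideal R a)}) x.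

Lemma cyclic_class_eq (R : nzRingType) (a x y : R) :
  cyclic_class R a x = cyclic_class R a y <->
  x - y \in principal_right_ideal R a.
Proof. by rewrite Quotient.idealrBE; split=> [/eqP|/eqP]. Qed.

Lemma cyclic_class_surj (R : nzRingType) (a : R) (q : cyclic_quotient R a) :
  exists x, q = cyclic_class R a x.
Proof. by exists (repr q); rewrite /cyclic_class reprK. Qed.

Lemma cyclic_classD (R : nzRingType) (a x y : R) :
  cyclic_class R a (x + y) = cyclic_class R a x + cyclic_class R a y.
Proof. exact: Quotient.pi_add. Qed.

Lemma cyclic_class0 (R : nzRingType) (a : R) : cyclic_class R a 0 = 0.
Proof. by apply: (addIr (cyclic_class R a 0)); rewrite -cyclic_classD !add0r. Qed.

(** Acting on the chosen representative is harmless because aR is a right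
    ideal; [cyclic_scaleE] records this independence, and the module axioms
    follow from it. *)
Definition cyclic_scale (R : nzRingType) (a : R) (r : R^c)
    (q : cyclic_quotient R a) : cyclic_quotient R a :=
  cyclic_class R a (repr (q : {ideal_quot (principal_right_ideal R a)}) * (r : R)).

Lemma cyclic_scaleE (R : nzRingType) (a r x : R) :
  cyclic_scale R a r (cyclic_class R a x) = cyclic_class R a (x * r).
Proof.
apply/cyclic_class_eq; rewrite -mulrBl; apply: principal_right_idealMr.
by apply/cyclic_class_eq; rewrite /cyclic_class reprK.
Qed.

Fact cyclic_scaleA (R : nzRingType) (a : R) (r s : R^c)
    (q : cyclic_quotient R a) :
  cyclic_scale R a r (cyclic_scale R a s q) = cyclic_scale R a (r * s) q.
Proof.
by have [x ->] := cyclic_class_surj R a q; rewrite !cyclic_scaleE -mulrA.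
Qed.

Fact cyclic_scale1 (R : nzRingType) (a : R) :
  left_id (1 : R^c) (cyclic_scale R a).
Proof.
by move=> q; have [x ->] := cyclic_class_surj R a q; rewrite cyclic_scaleE mulr1.
Qed.

Fact cyclic_scaleDr (R : nzRingType) (a : R) :
  right_distributive (cyclic_scale R a) +%R.
Proof.
move=> r p q.
have [x ->] := cyclic_class_surj R a p; have [y ->] := cyclic_class_surj R a q.
by rewrite -cyclic_classD !cyclic_scaleE mulrDl cyclic_classD.
Qed.

Fact cyclic_scaleDl (R : nzRingType) (a : R) (q : cyclic_quotient R a) :
  {morph (cyclic_scale R a)^~ q : r s / r + s}.
Proof.
move=> r s; have [x ->] := cyclic_class_surj R a q.
by rewrite !cyclic_scaleE mulrDr cyclic_classD.
Qed.

HB.instance Definition _ (R : nzRingType) (a : R) :=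
  GRing.Zmodule_isLmodule.Build R^c (cyclic_quotient R a)
    (cyclic_scaleA R a) (cyclic_scale1 R a) (cyclic_scaleDr R a)
    (cyclic_scaleDl R a).

(** Since (x + aR) a = xa + aR, the duo condition, which puts xa in aR, makes
    a kill the whole quotient and not only the class of 1. *)
Lemma right_duo_annihilates_quotient (R : nzRingType) (a : R)
    (q : cyclic_quotient R a) :
  right_duo R -> ann (M := cyclic_quotient R a) q a.
Proof.
move=> duoR; have [x ->] := cyclic_class_surj R a q.
have [r _ xaE] := duoR a (x * a) (imageT (fun t => t * a) x).
rewrite /ann /= -[RHS](cyclic_class0 R a) [LHS]cyclic_scaleE.
apply/cyclic_class_eq.
by apply/principal_right_idealP; exists r; rewrite subr0.
Qed.

(** A nonzero a that kills the whole module lies in every annihilator, so no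
    element is torsion free and a nonzero m has no decomposition. *)
Lemma fusible_common_annihilator_eq0 (R : nzRingType) (M : rmodType R) (a : R) :
  fusible M -> a != 0 -> (forall m : M, ann m a) -> forall m : M, m = 0.
Proof.
move=> fusM a0 annM m; apply/eqP/negP => /negP m0.
have [_ [y [_ yfree _]]] := fusM m m0.
by have := annM y; rewrite yfree => /= /eqP; rewrite (negPf a0).
Qed.

Lemma cyclic_quotient_eq0_right_inverse (R : nzRingType) (a : R) :
  (forall q : cyclic_quotient R a, q = 0) -> exists b, a * b = 1.
Proof.
move=> Q0; have /cyclic_class_eq : cyclic_class R a 1 = cyclic_class R a 0.
  by rewrite [LHS]Q0 [RHS]Q0.
by rewrite subr0 => /principal_right_idealP[b ->]; exists b.
Qed.

(** A right inverse b of a is itself nonzero, so it has a right inverse c; then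
    b is invertible on both sides with inverse a = c. *)
Lemma division_ring_of_right_inverses (R : nzRingType) :
  (forall a : R, a != 0 -> exists b, a * b = 1) -> division_ring R.
Proof.
move=> rinv a a0; have [b ab1] := rinv a a0.
have b0 : b != 0.
  by apply/eqP => b0; move: ab1 => /eqP; rewrite b0 mulr0 eq_sym oner_eq0.
have [c bc1] := rinv b b0.
have ac : a = c by rewrite -[a]mulr1 -bc1 mulrA ab1 mul1r.
by exists b; split=> //; rewrite {1}ac.
Qed.

Lemma torsion0 (R : nzRingType) (M : rmodType R) : torsion (0 : M).
Proof.
move=> ann0; have : ann (0 : M) 1 by rewrite /ann /rscale /= scaler0.
by rewrite ann0 => /= /eqP; rewrite oner_eq0.
Qed.

Lemma division_ring_torsion_free (R : nzRingType) (M : rmodType R) (m : M) :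
  division_ring R -> m != 0 -> torsion_free m.
Proof.
move=> divR m0; apply/seteqP; split=> r /=; last first.
  by move=> ->; rewrite /ann /rscale /= scale0r.
move=> mr0; apply/eqP/negP => /negP r0; have [s [rs1 _]] := divR r r0.
move/eqP: m0; apply.
have : rscale (rscale m r) s = 0 by rewrite mr0 /rscale scaler0.
by rewrite rscaleA rs1 /rscale scale1r.
Qed.

Theorem theorem8 (R : nzRingType) (hR : right_duo R) :
  (forall M : rmodType R, fusible M) <-> division_ring R.
Proof.
split=> [fusR | divR M m m0]; last first.
  exists 0, m; split; first exact: torsion0.
    exact: division_ring_torsion_free.
  by rewrite add0r.
apply: division_ring_of_right_inverses => a a0.
apply: cyclic_quotient_eq0_right_inverse.
apply: (fusible_common_annihilator_eq0 R (cyclic_quotient R a) a) => // q.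
exact: right_duo_annihilates_quotient.
Qed.
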